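(* Let $\mathcal{H}$ be a Hilbert space of finite dimension $d$ and take $\mathcal{H}_{\text{anc}}=\mathcal{H}_{\text{in}}=\mathcal{H}_{\text{out}}=\mathcal{H}$. For $l\in\{1,2\}$ let $\{\ket{\Psi^{(l)}_i}\}_{i=0}^{d^2-1}$ be a maximally entangled basis of $\mathcal{H}\otimes\mathcal{H}$, let $\Omega_l=\{x^{(l)}_0,\dots,x^{(l)}_{d^2-1}\}$ be outcome sets with $\Omega_1\cap\Omega_2=\emptyset$, let $\mathsf{E}^{(l)}$ be the POVM with elements $\mathsf{E}^{(l)}(x^{(l)}_i)=\ket{\Psi^{(l)}_i}\bra{\Psi^{(l)}_i}$, and let $\mathsf{T}^{(l)}(x^{(l)}_i)=(\Upsilon^{*}_{P_+}\otimes\mathcal{I}_{\text{out}})(\mathsf{E}^{(l)}(x^{(l)}_i))$ be the elements of the tester associated with the maximally entangled input state $P_+$ and $\mathsf{E}^{(l)}$. Put $$\tilde{c}(x^{(1)}_i,x^{(2)}_j):=d\left\lVert\tfrac12\mathsf{T}^{(1)}(x^{(1)}_i)+\tfrac12\mathsf{T}^{(2)}(x^{(2)}_j)\right\rVert_{\text{op}}.$$ Then for all $i,j\in\{0,\dots,d^2-1\}$, $$\tilde{c}(x^{(1)}_i,x^{(2)}_j)=\frac12\left(1+\left|\braket{\Psi^{(1)}_i|\Psi^{(2)}_j}\right|\right).$$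
   Context: All Hilbert spaces are finite-dimensional (complex). $\mathcal{L}(\mathcal{H})$ is the set of linear operators on $\mathcal{H}$; $\mathcal{I}_\bullet$ is the identity map on $\mathcal{L}(\mathcal{H}_\bullet)$; $\lVert\cdot\rVert_{\text{op}}$ is the operator norm. A POVM is a finite family of positive operators summing to the identity. Fix an orthonormal basis $\{\ket{i}\}_{i=0}^{d-1}$ of $\mathcal{H}$. Put $P'_+=\sum_{i,j=0}^{d-1}\ket{i}\bra{j}\otimes\ket{i}\bra{j}$ and $P_+=P'_+/d$, a state (positive operator of trace $1$) on $\mathcal{H}_{\text{anc}}\otimes\mathcal{H}_{\text{in}}=\mathcal{H}\otimes\mathcal{H}$. Write $\ket{\Psi_+}=\frac{1}{\sqrt d}\sum_{i=0}^{d-1}\ket{i\otimes i}$. A unit vector of $\mathcal{H}\otimes\mathcal{H}$ is maximally entangled if it has the form $(I\otimes U)\ket{\Psi_+}$ with $U$ unitary on $\mathcal{H}$; a maximally entangled basis (MEB) of $\mathcal{H}\otimes\mathcal{H}$ is an orthonormal basis consisting of maximally entangled vectors. For a state $\rho$ on $\mathcal{H}_{\text{anc}}\otimes\mathcal{H}_{\text{in}}$, $\Upsilon_\rho:\mathcal{L}(\mathcal{H}_{\text{in}})\to\mathcal{L}(\mathcal{H}_{\text{anc}})$ is the completely positive map determined by $\rho=(\Upsilon_\rho\otimes\mathcal{I}_{\text{in}})(P'_+)$, and $\Upsilon_\rho^{*}$ is its dual: $\mathrm{tr}[A^\dagger\Upsilon_\rho(B)]=\mathrm{tr}[\Upsilon_\rho^{*}(A)^\dagger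 B]$ for all $A\in\mathcal{L}(\mathcal{H}_{\text{anc}})$, $B\in\mathcal{L}(\mathcal{H}_{\text{in}})$. For $\rho=P_+$ one has $\Upsilon_{P_+}^{*}=\frac1d\,\mathcal{I}$, so that $\mathsf{T}^{(l)}(x^{(l)}_i)=\frac1d\ket{\Psi^{(l)}_i}\bra{\Psi^{(l)}_i}$. *)

(* Defs.v *)
From HB Require Import structures.
From mathcomp Require Import all_boot all_order all_algebra.
From mathcomp Require Import classical_sets reals.
From mathcomp Require Import complex mxtens.

Set Implicit Arguments.
Unset Strict Implicit.
Unset Printing Implicit Defensive.

Import Order.TTheory GRing.Theory Num.Theory.
Local Open Scope ring_scope.
Local Open Scope complex_scope.
Local Open Scope sesquilinear_scope.

(* The Hilbert space of dimension n is C^n (kets are columns, C = R[i]) with its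
   standard orthonormal basis, L(H) is 'M[R[i]]_n, and the tensor product of C^m
   and C^n is C^(m * n), products of vectors and of operators both being the
   Kronecker product [*t] of mxtens; [mxtens_index (i, j)] is the index of the
   basis ket i (x) j. *)

Definition ket (R : realType) (n : nat) (i : 'I_n) : 'cV[R[i]]_n :=
  delta_mx i 0.

Arguments ket R {n} i.

Definition braket (R : realType) (n : nat) (u v : 'cV[R[i]]_n) : R[i] :=
  (u^t* *m v) 0 0.

Definition ketbra (R : realType) (m n : nat) (u : 'cV[R[i]]_m)
  (v : 'cV[R[i]]_n) : 'M[R[i]]_(m, n) := u *m v^t*.

Definition vnorm (R : realType) (n : nat) (v : 'cV[R[i]]_n) : R :=
  Num.sqrt (complex.Re (braket v v)).

(* The library norm on matrices is the maximum of the entries; this is the norm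
   induced by the Hilbert-space norm. *)
Definition opnorm (R : realType) (n : nat) (A : 'M[R[i]]_n) : R :=
  sup [set vnorm (A *m v) | v in [set v : 'cV[R[i]]_n | vnorm v <= 1]]%classic.

(* In R[i], 0 <= z says that z is real and nonnegative. *)
Definition psd (R : realType) (n : nat) (A : 'M[R[i]]_n) : Prop :=
  forall v : 'cV[R[i]]_n, 0 <= braket v (A *m v).

(* Only the values on Omega are constrained. *)
Record povm (R : realType) (X : finType) (Omega : {set X}) (n : nat) := POVM {
  effect :> X -> 'M[R[i]]_n;
  effect_psd : forall x, x \in Omega -> psd (effect x);
  effect_sum : \sum_(x in Omega) effect x = 1%:M
}.

(* Phi (x) Psi, expanded on the matrix units
   delta_mx i j (x) delta_mx k l; see tens_opE. *)
Definition tens_op (R : realType) (m n p q : nat)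
    (Phi : 'Hom('M[R[i]]_m, 'M[R[i]]_n)) (Psi : 'Hom('M[R[i]]_p, 'M[R[i]]_q))
    (X : 'M[R[i]]_(m * p)) : 'M[R[i]]_(n * q) :=
  \sum_(i < m) \sum_(j < m) \sum_(k < p) \sum_(l < p)
    X (mxtens_index (i, k)) (mxtens_index (j, l)) *:
      (Phi (delta_mx i j) *t Psi (delta_mx k l)).

Lemma tens_opE (R : realType) (m n p q : nat)
    (Phi : 'Hom('M[R[i]]_m, 'M[R[i]]_n)) (Psi : 'Hom('M[R[i]]_p, 'M[R[i]]_q))
    (A : 'M[R[i]]_m) (B : 'M[R[i]]_p) :
  tens_op Phi Psi (A *t B) = Phi A *t Psi B.
Proof.
rewrite /tens_op [in RHS](matrix_sum_delta A) [in RHS](matrix_sum_delta B).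
rewrite !linear_sum /=; apply/matrixP => u v.
rewrite mxE !summxE mulr_suml; apply: eq_bigr => i _.
rewrite linear_sum !summxE mulr_suml; apply: eq_bigr => j _.
rewrite summxE mulr_sumr; apply: eq_bigr => k _.
rewrite linear_sum !summxE mulr_sumr; apply: eq_bigr => l _.
by rewrite !linearZ /= !mxE !mxtens_indexK /= mulrACA.
Qed.

Definition completely_positive (R : realType) (m n : nat)
    (Phi : 'Hom('M[R[i]]_m, 'M[R[i]]_n)) : Prop :=
  forall (k : nat) (X : 'M[R[i]]_(k * m)),
    psd X -> psd (tens_op (\1%VF : 'End('M[R[i]]_k)) Phi X).

(* P'_+ *)
Definition Pplus' (R : realType) (d : nat) : 'M[R[i]]_(d * d) :=
  \sum_(i < d) \sum_(j < d)
    (ketbra (ket R i) (ket R j) *t ketbra (ket R i) (ket R j)).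

Definition Pplus (R : realType) (d : nat) : 'M[R[i]]_(d * d) :=
  d%:R^-1 *: Pplus' R d.

Definition Psiplus (R : realType) (d : nat) : 'cV[R[i]]_(d * d) :=
  (sqrtC d%:R)^-1 *: \sum_(i < d) (ket R i *t ket R i : 'cV[R[i]]_(d * d)).

(* Upsilon rho and dual_op Phi are definite descriptions: xget 0 picks an element
   of the set (0 if it is empty). A linear Phi is determined by its Choi matrix
   tens_op Phi \1 (Pplus' R n), and by its dual through the trace pairing, so each
   set has at most one element; for psd rho, resp. any Phi, it has one.
   Here m and n are the dimensions of the ancilla and input spaces. *)
Definition Upsilon (R : realType) (m n : nat) (rho : 'M[R[i]]_(m * n)) :
    'Hom('M[R[i]]_n, 'M[R[i]]_m) :=
  xget 0 [set Phi | completely_positive Phi /\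
                    rho = tens_op Phi (\1%VF : 'End('M[R[i]]_n)) (Pplus' R n)]%classic.

Definition dual_op (R : realType) (m n : nat)
    (Phi : 'Hom('M[R[i]]_n, 'M[R[i]]_m)) : 'Hom('M[R[i]]_m, 'M[R[i]]_n) :=
  xget 0 [set Psi : 'Hom('M[R[i]]_m, 'M[R[i]]_n) |
    forall (A : 'M[R[i]]_m) (B : 'M[R[i]]_n),
      \tr (A^t* *m Phi B) = \tr ((Psi A)^t* *m B)]%classic.

(* E acts on anc (x) out, the tester elements on in (x) out. *)
Definition tester (R : realType) (X : Type) (anc inp out : nat)
    (rho : 'M[R[i]]_(anc * inp)) (E : X -> 'M[R[i]]_(anc * out)) (x : X) :
    'M[R[i]]_(inp * out) :=
  tens_op (dual_op (Upsilon rho)) (\1%VF : 'End('M[R[i]]_out)) (E x).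

Definition ctilde (R : realType) (X : Type) (d : nat)
    (T1 T2 : X -> 'M[R[i]]_(d * d)) (x y : X) : R :=
  d%:R * opnorm (2%:R^-1 *: T1 x + 2%:R^-1 *: T2 y).

Definition orthonormal_basis (R : realType) (n N : nat)
    (Psi : 'I_N -> 'cV[R[i]]_n) : Prop :=
  (forall i j, braket (Psi i) (Psi j) = (i == j)%:R) /\
  basis_of fullv [seq Psi i | i <- enum 'I_N].

Definition maximally_entangled (R : realType) (d : nat)
    (psi : 'cV[R[i]]_(d * d)) : Prop :=
  vnorm psi = 1 /\
  exists2 U : 'M[R[i]]_d, U \is unitarymx & psi = (1%:M *t U) *m Psiplus R d.

Definition maximally_entangled_basis (R : realType) (d : nat)
    (Psi : 'I_(d ^ 2) -> 'cV[R[i]]_(d * d)) : Prop :=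
  orthonormal_basis Psi /\ forall i, maximally_entangled (Psi i).

(* Main.v *)
(* For the maximally entangled input, Upsilon and its dual are both I/d, so the
   tester elements are the projectors divided by d. With u and v the two unit
   vectors, the claim becomes || |u><u| + |v><v| || = 1 + |<u|v>|. *)

Require Import Defs.
From mathcomp Require Import classical_sets.
From HB Require Import structures.
From mathcomp Require Import all_boot all_order all_algebra.
From mathcomp Require Import reals.
From mathcomp Require Import complex mxtens ring.

Set Implicit Arguments.
Unset Strict Implicit.
Unset Printing Implicit Defensive.

Import Order.TTheory GRing.Theory Num.Theory.
Local Open Scope ring_scope.
Local Open Scope complex_scope.

(** * The inner product and rank-one operators *)

Lemma braketE (R : realType) n (u v : 'cV[R[i]]_n) :
  braket u v = \sum_i Num.conj (u i 0) * v i 0.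
Proof. by rewrite /braket !mxE; apply: eq_bigr => i _; rewrite !mxE. Qed.

Lemma braketDr (R : realType) n (u v w : 'cV[R[i]]_n) :
  braket u (v + w) = braket u v + braket u w.
Proof. by rewrite /braket mulmxDr mxE. Qed.

Lemma braketZr (R : realType) n a (u v : 'cV[R[i]]_n) :
  braket u (a *: v) = a * braket u v.
Proof. by rewrite /braket -scalemxAr mxE. Qed.

Lemma conj_braket (R : realType) n (u v : 'cV[R[i]]_n) :
  Num.conj (braket u v) = braket v u.
Proof.
rewrite !braketE rmorph_sum; apply: eq_bigr => i _.
by rewrite rmorphM /= conjCK mulrC.
Qed.

Lemma braketDl (R : realType) n (u v w : 'cV[R[i]]_n) :
  braket (u + v) w = braket u w + braket v w.
Proof. by rewrite -conj_braket braketDr rmorphD /= !conj_braket. Qed.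

Lemma braketZl (R : realType) n a (u v : 'cV[R[i]]_n) :
  braket (a *: u) v = Num.conj a * braket u v.
Proof. by rewrite -conj_braket braketZr rmorphM /= conj_braket. Qed.

Lemma braket_ge0 (R : realType) n (v : 'cV[R[i]]_n) : 0 <= braket v v.
Proof.
rewrite braketE; apply: sumr_ge0 => i _.
by rewrite mulrC -normCK exprn_ge0.
Qed.

Lemma ketbra_mul (R : realType) m n (u : 'cV[R[i]]_m) (v w : 'cV[R[i]]_n) :
  ketbra u v *m w = braket v w *: u.
Proof.
by rewrite /ketbra -mulmxA [X in _ *m X]mx11_scalar mul_mx_scalar.
Qed.

Lemma ketbra_ket (R : realType) n (i j : 'I_n) :
  ketbra (ket R i) (ket R j) = delta_mx i j.
Proof.
rewrite /ketbra /ket trmx_delta.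
have -> : map_mx Num.conj (delta_mx 0 j : 'rV[R[i]]_n) = delta_mx 0 j.
  by apply/matrixP => k l; rewrite !mxE rmorph_nat.
by rewrite mul_delta_mx.
Qed.

(** * Vector norms, and the operator norm of a sum of two rank-one projectors *)

Lemma vnorm_ge0 (R : realType) n (v : 'cV[R[i]]_n) : 0 <= vnorm v.
Proof. exact: sqrtr_ge0. Qed.

(** A self-bracket is nonnegative in [R[i]], so its imaginary part vanishes and the [complex.Re] in
    [vnorm] loses nothing. *)
Lemma vnormE (R : realType) n (v : 'cV[R[i]]_n) :
  (vnorm v)%:C ^+ 2 = braket v v.
Proof.
rewrite -rmorphXn /=.
have := braket_ge0 v; rewrite /vnorm; case: (braket v v) => a b.
by rewrite lecE /= => /andP[/eqP -> ?] /=; rewrite sqr_sqrtr.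
Qed.

Lemma vnormZ (R : realType) n (a : R[i]) (v : 'cV[R[i]]_n) :
  (vnorm (a *: v))%:C = `|a| * (vnorm v)%:C.
Proof.
apply/eqP; rewrite -(@eqrXn2 _ 2) ?mulr_ge0 ?normr_ge0 ?ler0c ?vnorm_ge0 //.
rewrite exprMn !vnormE braketZl braketZr mulrA.
by rewrite normCK [X in X * _ == _]mulrC.
Qed.

(** The quadratic bound makes [c] an upper bound of the set under the supremum, and the normalized
    eigenvector attains it. Bounding squares keeps the hypothesis free of square roots. *)
Lemma opnorm_eigen (R : realType) n (A : 'M[R[i]]_n) (c : R)
    (w : 'cV[R[i]]_n) :
  0 <= c -> (forall v, braket (A *m v) (A *m v) <= c%:C ^+ 2 * braket v v) ->
  braket w w != 0 -> A *m w = c%:C *: w -> opnorm A = c.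
Proof.
move=> c_ge0 A_le w_neq0 Aw.
have ub v : vnorm v <= 1 -> vnorm (A *m v) <= c.
  move=> v1; have := A_le v; rewrite -!vnormE -!rmorphXn -rmorphM lecR /=.
  rewrite -exprMn ler_pXn2r ?nnegrE ?mulr_ge0 ?vnorm_ge0 // => /le_trans; apply.
  by rewrite ler_piMr.
have wn : vnorm w != 0.
  by apply: contraNneq w_neq0; rewrite -vnormE => ->; rewrite expr0n.
pose w1 := ((vnorm w)^-1)%:C *: w.
have w11 : vnorm w1 = 1.
  apply: (@complexI R); rewrite vnormZ ger0_norm ?ler0c ?invr_ge0 ?vnorm_ge0 //.
  by rewrite -rmorphM /= mulVf.
have Aw1 : vnorm (A *m w1) = c.
  apply: (@complexI R).
  rewrite -scalemxAr Aw scalerA mulrC -scalerA vnormZ w11 mulr1.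
  by rewrite ger0_norm // ler0c.
rewrite /opnorm; set S := (X in sup X).
have Sc : S c by exists w1 => //=; rewrite w11.
have cS : ubound S c by move=> _ [v /= v1 <-]; exact: ub.
apply/eqP; rewrite eq_le; apply/andP; split.
  by apply: ge_sup => //; exists c.
by apply: ub_le_sup => //; exists c.
Qed.

(* Writing A = |u><u| + |v><v| and s = |<u|v>|, AM-GM on the cross term gives
   A^2 <= (1 + s) A. Then A <= 1 + s follows from |((1 + s) - A) w|^2 >= 0, with
   no appeal to Cauchy-Schwarz. *)
Lemma ketbraD_bound (R : realType) n (u v w : 'cV[R[i]]_n) :
    braket u u = 1 -> braket v v = 1 ->
  braket ((ketbra u u + ketbra v v) *m w) ((ketbra u u + ketbra v v) *m w) <=
    (1 + `|braket u v|) ^+ 2 * braket w w.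
Proof.
move=> uu vv; rewrite mulmxDl !ketbra_mul.
set a := braket u w; set b := braket v w; set g := braket u v.
have wu : braket w u = Num.conj a by rewrite conj_braket.
have wv : braket w v = Num.conj b by rewrite conj_braket.
have vu : braket v u = Num.conj g by rewrite conj_braket.
set x := a *: u + b *: v; set s := `|g|.
have s_ge0 : 0 <= s by exact: normr_ge0.
have wx : braket w x = `|a| ^+ 2 + `|b| ^+ 2.
  by rewrite braketDr !braketZr wu wv !normCK.
have xw : braket x w = `|a| ^+ 2 + `|b| ^+ 2.
  by rewrite -conj_braket wx rmorphD /= !rmorphXn /= !conj_normC.
have xx : braket x x = `|a| ^+ 2 + `|b| ^+ 2 +
    (Num.conj a * b * g + Num.conj (Num.conj a * b * g)).
  rewrite /x !braketDl !braketDr !braketZl !braketZr uu vv vu -/g.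
  rewrite !rmorphM /= !conjCK !normCK.
  ring.
(* The left side is twice the real part of [z]. *)
have cross (z : R[i]) : z + Num.conj z <= `|z| *+ 2.
  rewrite (le_trans (real_ler_norm _)) //.
    by rewrite CrealE rmorphD /= conjCK addrC.
  by rewrite (le_trans (ler_normD _ _)) // norm_conjC mulr2n.
have x_le : braket x x <= (1 + s) * (`|a| ^+ 2 + `|b| ^+ 2).
  rewrite xx mulrDl mul1r lerD2l (le_trans (cross _)) //.
  rewrite !normrM norm_conjC -/s -mulrnAl mulrC ler_wpM2l //.
  have : 0 <= (`|a| - `|b|) ^+ 2 by rewrite -realEsqr rpredB ?normr_real.
  by rewrite sqrrB addrAC subr_ge0.
clearbody x; have := braket_ge0 ((1 + s) *: w + -1 *: x).
rewrite braketDl !braketDr !braketZl !braketZr wx xw.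
rewrite rmorphD rmorphN rmorph1 /= conj_normC -/s.
set q := _ + _ ^+ 2; set y := braket x x; set z := braket w w => h.
have {}h : (1 + s) * q *+ 2 - y <= (1 + s) ^+ 2 * z.
  rewrite -subr_ge0; apply: le_trans h _; rewrite le_eqVlt; apply/orP; left.
  by apply/eqP; ring.
(* By [x_le], [y] is at most [(1 + s) * q], so replacing one of the two copies by [y] leaves at
   least [y]. *)
apply: le_trans h; rewrite mulr2n.
by rewrite (le_trans x_le) // -addrA lerDl subr_ge0.
Qed.

(** [ketbraD_bound] gives the upper bound and an explicit eigenvector attains it. The factor [k] is
    carried along to absorb the scalars of the tester elements. *)
Lemma opnorm_ketbraD (R : realType) n (u v : 'cV[R[i]]_n) (k : R) :
    0 <= k -> braket u u = 1 -> braket v v = 1 ->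
  (opnorm (k%:C *: (ketbra u u + ketbra v v)))%:C = k%:C * (1 + `|braket u v|).
Proof.
move=> k_ge0 uu vv; set g := braket u v.
have vu : braket v u = Num.conj g by rewrite conj_braket.
have [r r_ge0 gE] : exists2 r : R, 0 <= r & `|g| = r%:C.
  have /complex_realP[r rE] := normr_real g.
  by exists r; rewrite // -ler0c -rE.
(* The phase e turns u + e v into a top eigenvector, of eigenvalue 1 + |g|. *)
have [e ee eg] : exists2 e : R[i], Num.conj e * e = 1 & e * g = `|g|.
  (* At [g = 0] the quotient chosen below would be 0, not a phase; there any phase works. *)
  have [g0|g0] := eqVneq g 0.
    by exists 1; rewrite ?g0 ?rmorph1 ?mulr1 ?normr0 ?mulr0.
  exists (Num.conj g / `|g|).
    rewrite rmorphM fmorphV /= conjCK conj_normC.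
    rewrite mulrACA -normCK expr2 -invfM mulfV //.
    by rewrite mulf_neq0 ?normr_eq0.
  by rewrite mulrAC [_ * g]mulrC -normCK expr2 mulfK ?normr_eq0.
have eg' : Num.conj g = e * `|g|.
  by rewrite -[LHS]mul1r -ee mulrAC -rmorphM /= eg conj_normC mulrC.
pose w := u + e *: v.
have Bw : (ketbra u u + ketbra v v) *m w = (1 + `|g|) *: w.
  rewrite mulmxDl !ketbra_mul !braketDr !braketZr uu vv vu -/g eg eg' mulr1.
  by rewrite scalerDr scalerA mulrDl mul1r [e * `|g|]mulrC [_ + e]addrC.
have ww : braket w w = (1 + `|g|) *+ 2.
  rewrite braketDl !braketDr !braketZl !braketZr uu vv vu -/g eg eg'.
  ring: ee.
have c_ge0 : 0 <= k * (1 + r) by rewrite mulr_ge0 ?addr_ge0.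
rewrite gE -[1]/(1%:C) -rmorphD -rmorphM /=; congr (_%:C).
apply: (opnorm_eigen (w := w)) => //.
- move=> v'; rewrite -scalemxAl braketZl braketZr mulrA.
  have -> : Num.conj k%:C = k%:C :> R[i].
    by apply/CrealP/complex_realP; exists k.
  rewrite rmorphM rmorphD rmorph1 /= -gE exprMn -expr2 -[leRHS]mulrA.
  by rewrite ler_wpM2l ?exprn_ge0 ?ler0c // ketbraD_bound.
- by rewrite ww mulrn_eq0 /= lt0r_neq0 // ltr_wpDr.
- by rewrite -scalemxAl Bw scalerA rmorphM rmorphD rmorph1 /= gE.
Qed.

(** * Tensor products of maps and Choi matrices *)

(** In the expansion on matrix units, the entry at row (p, q) and column (p', q') receives a
    contribution only from the unit with exactly these indices; the other terms are discarded one
    sum at a time. *)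
Lemma tens_op_scale (R : realType) m n (a b : R[i]) (X : 'M[R[i]]_(m * n)) :
  tens_op (a *: \1%VF : 'End('M[R[i]]_m)) (b *: \1%VF : 'End('M[R[i]]_n)) X =
  (a * b) *: X.
Proof.
apply/matrixP => s t; case: (mxtens_indexP s) => p q.
case: (mxtens_indexP t) => p' q'.
rewrite mxE !summxE (bigD1 p) //= summxE (bigD1 p') //=.
rewrite summxE (bigD1 q) //= summxE (bigD1 q') //=.
rewrite mxE tensmxE !lfunE /= !lfunE /= !mxE !eqxx !mulr1 mulrC.
rewrite big1 ?addr0 => [|l neq]; last first.
  rewrite mxE tensmxE !lfunE /= !lfunE /= !mxE [q' == l]eq_sym (negPf neq).
  by rewrite andbF !mulr0.
rewrite big1 ?addr0 => [|k neq]; last first.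
  rewrite summxE big1 // => l _.
  rewrite mxE tensmxE !lfunE /= !lfunE /= !mxE [q == k]eq_sym (negPf neq).
  by rewrite !mulr0.
rewrite big1 ?addr0 => [|j neq]; last first.
  rewrite summxE big1 // => k _; rewrite summxE big1 // => l _.
  rewrite mxE tensmxE !lfunE /= !lfunE /= !mxE [p' == j]eq_sym (negPf neq).
  by rewrite andbF mulr0 mul0r mulr0.
rewrite big1 ?addr0 // => j neq.
rewrite summxE big1 // => k' _; rewrite summxE big1 // => k _.
rewrite summxE big1 // => l _.
rewrite mxE tensmxE !lfunE /= !lfunE /= !mxE [p == j]eq_sym (negPf neq).
by rewrite mulr0 mul0r mulr0.
Qed.

Lemma tens_op_id1Z (R : realType) m n (a : R[i]) (X : 'M[R[i]]_(m * n)) :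
  tens_op (a *: \1%VF : 'End('M[R[i]]_m)) (\1%VF : 'End('M[R[i]]_n)) X =
  a *: X.
Proof.
by rewrite -[X in tens_op _ X]scale1r tens_op_scale mulr1.
Qed.

Lemma Pplus'E (R : realType) d (i j k l : 'I_d) :
  Pplus' R d (mxtens_index (i, k)) (mxtens_index (j, l)) =
  (i == k)%:R * (j == l)%:R.
Proof.
rewrite /Pplus' summxE (bigD1 i) //= summxE (bigD1 j) //=.
rewrite tensmxE !ketbra_ket !mxE !eqxx /= mul1r.
rewrite big1 ?addr0 => [|j' neq]; last first.
  by rewrite tensmxE !ketbra_ket !mxE [j == j']eq_sym (negPf neq) andbF mul0r.
rewrite big1 ?addr0 => [|i' neq]; last first.
  rewrite summxE big1 // => j' _.
  by rewrite tensmxE !ketbra_ket !mxE [i == i']eq_sym (negPf neq) mul0r.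
by rewrite -natrM mulnb ![k == _]eq_sym ![l == _]eq_sym.
Qed.

(** The blocks of the Choi matrix are the values of [Phi] on matrix units: [Pplus'] forces the two
    units of a term to coincide, and the identity factor selects [delta_mx k l]. *)
Lemma tens_op_Pplus'E (R : realType) m n
    (Phi : 'Hom('M[R[i]]_n, 'M[R[i]]_m)) (a b : 'I_m) (k l : 'I_n) :
  tens_op Phi (\1%VF : 'End('M[R[i]]_n)) (Pplus' R n)
    (mxtens_index (a, k)) (mxtens_index (b, l)) = Phi (delta_mx k l) a b.
Proof.
have termE i j k' l' :
  (Pplus' R n (mxtens_index (i, k')) (mxtens_index (j, l')) *:
    (Phi (delta_mx i j) *t (\1%VF : 'End('M[R[i]]_n)) (delta_mx k' l')))
    (mxtens_index (a, k)) (mxtens_index (b, l)) =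
  [&& i == k, j == l, k' == k & l' == l]%:R * Phi (delta_mx k l) a b.
  rewrite mxE tensmxE Pplus'E id_lfunE mxE [k == k']eq_sym [l == l']eq_sym.
  have [->|?] := eqVneq k' k; last by rewrite !mulr0 !andbF mul0r.
  have [->|?] := eqVneq l' l; last by rewrite !mulr0 !andbF mul0r.
  have [->|?] := eqVneq i k; last by rewrite !mul0r.
  have [->|?] := eqVneq j l; last by rewrite mulr0 !mul0r.
  by rewrite !mul1r mulr1.
rewrite summxE (bigD1 k) //= summxE (bigD1 l) //=.
rewrite summxE (bigD1 k) //= summxE (bigD1 l) //=.
rewrite termE !eqxx mul1r !big1 ?addr0 // => x neq;
  do ?[rewrite summxE big1 // => ? _];
  by rewrite termE (negPf neq) ?andbF mul0r.
Qed.

(** Matrix units span the domain, so the Choi matrix determines the map. This is the uniqueness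
    behind the description [Upsilon]. *)
Lemma tens_op_Pplus'_inj (R : realType) m n :
  injective (fun Phi : 'Hom('M[R[i]]_n, 'M[R[i]]_m) =>
    tens_op Phi (\1%VF : 'End('M[R[i]]_n)) (Pplus' R n)).
Proof.
move=> Phi Phi' /= eqPhi; apply/lfunP => A.
rewrite (matrix_sum_delta A) !linear_sum; apply: eq_bigr => k _.
rewrite !linear_sum; apply: eq_bigr => l _; rewrite !linearZ; congr (_ *: _).
by apply/matrixP => a b; rewrite -!tens_op_Pplus'E eqPhi.
Qed.

(** * The tester of the maximally entangled input *)

Lemma mxtrace_mul_delta (K : pzRingType) m n (M : 'M[K]_(m, n)) i j :
  \tr (M *m delta_mx i j) = M j i.
Proof.
rewrite /mxtrace (bigD1 j) //= big1 ?addr0 => [|k neq].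
  rewrite mxE (bigD1 i) //= big1 ?addr0 => [|l neq].
    by rewrite mxE !eqxx mulr1.
  by rewrite mxE (negPf neq) mulr0.
by rewrite mxE big1 // => l _; rewrite mxE (negPf neq) andbF mulr0.
Qed.

Lemma psdZ (R : realType) n (a : R[i]) (A : 'M[R[i]]_n) :
  0 <= a -> psd A -> psd (a *: A).
Proof. by move=> a_ge0 psdA v; rewrite -scalemxAl braketZr mulr_ge0. Qed.

Lemma Upsilon_Pplus (R : realType) d :
  Upsilon (Pplus R d) = d%:R^-1 *: \1%VF.
Proof.
have rhoE : Pplus R d =
    tens_op (d%:R^-1 *: \1%VF) (\1%VF : 'End('M[R[i]]_d)) (Pplus' R d).
  by rewrite tens_op_id1Z.
apply: xget_unique => [|Phi [_]]; last first.
  by rewrite rhoE => /tens_op_Pplus'_inj.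
(* Complete positivity: tensored with the identity on any ancilla, the map is still multiplication
   by a nonnegative scalar. *)
split=> // k X psdX; rewrite -[X in tens_op X]scale1r tens_op_scale mul1r.
by apply: psdZ; rewrite // invr_ge0.
Qed.

(** The trace pairing is conjugate-linear in its first argument, so passing to the dual conjugates
    the scalar; a real scalar is unchanged. *)
Lemma dual_op_scale (R : realType) n (a : R[i]) :
  Num.conj a = a ->
  dual_op (a *: \1%VF : 'End('M[R[i]]_n)) = a *: \1%VF.
Proof.
move=> aE; apply: xget_unique => [A B|Psi PsiE].
  rewrite !lfunE /= !lfunE /= [(_ *: _)^T]linearZ map_mxZ /= aE.
  by rewrite -scalemxAl -scalemxAr.
apply/lfunP => A; apply/matrixP => i j; rewrite !lfunE /= !lfunE /= mxE.
(* Pairing with [delta_mx i j] reads off the conjugates of the (i, j) entries; a further conjugation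
   removes the adjoint. *)
have := PsiE A (delta_mx i j); rewrite !lfunE /= !lfunE /= -scalemxAr mxtraceZ.
rewrite !mxtrace_mul_delta !mxE => /(congr1 Num.conj).
by rewrite rmorphM /= !conjCK aE.
Qed.

Lemma tester_Pplus (R : realType) (X : Type) d n
    (E : X -> 'M[R[i]]_(d * n)) x :
  tester (Pplus R d) E x = d%:R^-1 *: E x.
Proof.
rewrite /tester Upsilon_Pplus dual_op_scale ?tens_op_id1Z //.
by rewrite fmorphV rmorph_nat.
Qed.

Theorem proposition3 (R : realType) (d : nat)
  (Psi1 Psi2 : 'I_(d ^ 2) -> 'cV[R[i]]_(d * d))
  (MEB1 : maximally_entangled_basis Psi1)
  (MEB2 : maximally_entangled_basis Psi2)
  (X : finType) (Omega1 Omega2 : {set X})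
  (x1 x2 : 'I_(d ^ 2) -> X)
  (x1_inj : injective x1) (x2_inj : injective x2)
  (Omega1E : Omega1 = [set x1 i | i : 'I_(d ^ 2)])
  (Omega2E : Omega2 = [set x2 i | i : 'I_(d ^ 2)])
  (Omega_disj : Omega1 :&: Omega2 = set0)
  (E1 : povm R Omega1 (d * d)) (E2 : povm R Omega2 (d * d))
  (E1E : forall i, E1 (x1 i) = ketbra (Psi1 i) (Psi1 i))
  (E2E : forall i, E2 (x2 i) = ketbra (Psi2 i) (Psi2 i)) :
  let T1 := tester (out := d) (Pplus R d) E1 in
  let T2 := tester (out := d) (Pplus R d) E2 in
  forall i j : 'I_(d ^ 2),
    (ctilde T1 T2 (x1 i) (x2 j))%:C =
      2%:R^-1 * (1 + `|braket (Psi1 i) (Psi2 j)|).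
Proof.
(* For [d = 0] the index type is empty, so [i] itself yields the positivity needed to cancel [d]. *)
move=> T1 T2 i j; have d_gt0 : (0 < d)%N by case: (d) i => [[]|].
have [[[on1 _] _] [[on2 _] _]] := (MEB1, MEB2).
rewrite /ctilde /T1 /T2 !tester_Pplus E1E E2E -!scalerDr scalerA.
have -> : 2%:R^-1 * d%:R^-1 = (2%:R^-1 * d%:R^-1)%:C :> R[i].
  by rewrite rmorphM !fmorphV !rmorph_nat.
rewrite rmorphM /= opnorm_ketbraD ?on1 ?on2 ?eqxx //.
  (* The prefactor [d] of [ctilde] cancels the 1/d of the tester elements, leaving 1/2. *)
  rewrite rmorphM !fmorphV !rmorph_nat /= mulrA mulrCA mulfV ?mulr1 //.
  by rewrite pnatr_eq0 -lt0n.
by rewrite mulr_ge0 ?invr_ge0.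
Qed.
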